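(* Let $n$ agents, consisting of $m\ge 2$ stationary leaders (index set $\mathcal{L}$) and $n-m\ge 1$ followers (index set $\mathcal{F}$), interact over a directed graph $\mathcal{G}=(\mathcal{V},\mathcal{E},A)$, where every leader has at least one follower connected to it (i.e. for each $j\in\mathcal{L}$ there is $i\in\mathcal{F}$ with $(v_j,v_i)\in\mathcal{E}$) and the subgraph $\mathcal{G}^{\mathcal{F}}$ induced by the followers is strongly connected. Order the agents with the followers first and write the weighted adjacency matrix as $$A=\begin{bmatrix}A_1 & A_2\\ 0 & I_m\end{bmatrix},\qquad A_1\in\mathbb{R}^{(n-m)\times(n-m)},\ A_2\in\mathbb{R}^{(n-m)\times m},$$ and assume that $A_1$ and $A_2$ are both column stochastic. For an arbitrary initial condition $x(0)\in\mathbb{R}^n$, define $s(0)=x(0)$, $w(0)=1_n$ and, for $k\ge 0$, $$s(k+1)=A\,s(k),\qquad w(k+1)=A\,w(k),\qquad x_i(k+1)=\frac{s_i(k+1)}{w_i(k+1)}\ \text{ for all } i\in\mathcal{F},$$ while the leaders' states stay constant, $x_j(k)=x_j(0)$ for all $j\in\mathcal{L}$ and all $k\ge 0$. Then all followers converge to a consensus at the average of the leaders' states: $$\lim_{k\to\infty}x_i(k)=\frac{1}{m}\sum_{j\in\mathcal{L}}x_j(0)\qquad\text{for all } i\in\mathcal{F}.$$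
   Context: A directed graph $\mathcal{G}=(\mathcal{V},\mathcal{E},A)$ has vertex set $\mathcal{V}=\{v_1,\dots,v_n\}$ (one vertex per agent), a set $\mathcal{E}\subseteq\mathcal{V}\times\mathcal{V}$ of directed edges, each an ordered pair of distinct vertices, and a weighted adjacency matrix $A=[A^{ij}]\in\mathbb{R}^{n\times n}$. An edge $(v_j,v_i)\in\mathcal{E}$ means that agent $i$ can access the state of agent $j$. The entry $A^{ij}$ is the weight of the edge $(v_j,v_i)$: for $i\ne j$, $A^{ij}>0$ if $(v_j,v_i)\in\mathcal{E}$ and $A^{ij}=0$ otherwise; moreover $A^{ii}>0$ for all $i$. The in-neighbour set of $v_i$ is $\{v_j : (v_j,v_i)\in\mathcal{E}\}$. An agent is a leader if its in-neighbour set is empty; all other agents are followers. The graph $\mathcal{G}^{\mathcal{F}}$ is the subgraph induced by the vertices $v_i$, $i\in\mathcal{F}$. A directed graph is strongly connected if for every ordered pair of distinct vertices there is a directed path from the first to the second. A (possibly rectangular) matrix is column stochastic if its entries are nonnegative and each of its columns sums to $1$. $I_m$ is the $m\times m$ identity matrix and $1_n\in\mathbb{R}^n$ is the all-ones vector. Agent states are real numbers, and $x(k),s(k),w(k)\in\mathbb{R}^n$ have entries $x_i(k),s_i(k),w_i(k)$. *)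

(* Defs.v *)
From HB Require Import structures.
From mathcomp Require Import all_boot all_order all_algebra.
From mathcomp Require Import all_classical all_reals all_analysis.
Import Order.TTheory GRing.Theory Num.Theory.
Import numFieldNormedType.Exports.
Set Implicit Arguments.
Unset Strict Implicit.
Unset Printing Implicit Defensive.
Local Open Scope ring_scope.

(* [edge G j i] is the directed edge (v_j, v_i): agent i can access the state
   of agent j. Its weight is the entry [adj G i j], with indices swapped. *)
Record wdigraph (R : realType) (n : nat) := WDigraph {
  edge : rel 'I_n;
  adj : 'M[R]_n;
  edge_irrefl : irreflexive edge;
  adj_edge : forall i j, i != j -> edge j i -> 0 < adj i j;
  adj_nonedge : forall i j, i != j -> ~~ edge j i -> adj i j = 0;
  adj_diag : forall i, 0 < adj i i
}.

Definition in_neighbours (R : realType) (n : nat) (G : wdigraph R n) (i : 'I_n)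
  : {set 'I_n} := [set j | edge G j i].

Definition leaders (R : realType) (n : nat) (G : wdigraph R n) : {set 'I_n} :=
  [set i | in_neighbours G i == finset.set0].

Definition followers (R : realType) (n : nat) (G : wdigraph R n)
  : {set 'I_n} := [set i | i \notin leaders G].

Definition strongly_connected (T : finType) (e : rel T) : Prop :=
  forall u v : T, u != v -> connect e u v.

Definition induced_rel (T : finType) (e : rel T) (S : {set T})
  : rel {v : T | v \in S} := fun u v => e (val u) (val v).
Arguments induced_rel {T} e S u v.

Definition column_stochastic (R : realType) (p q : nat) (M : 'M[R]_(p, q))
  : Prop :=
  (forall i j, 0 <= M i j) /\ (forall j, \sum_i M i j = 1).

(* Main.v *)
(* Let [c] be the mean of the leaders' states and [y = s - c w], so that
   [x_i - c = y_i / w_i] on the followers. There [y(k+1) = A1 y(k) + d] with a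
   constant [d] of zero sum, hence the sum of the entries of [y] is conserved.
   Strong connectivity and the positive diagonal make some power of [A1]
   entrywise positive; that power contracts the l1 norm up to a multiple of the
   conserved sum, so [y] stays bounded. The total follower weight in [w] grows
   by [m] at each step, and the positive power spreads a fixed fraction of it to
   every follower, so each [w_i(k)] grows at least linearly. *)
Require Import Defs.
From HB Require Import structures.
From mathcomp Require Import all_boot all_order all_algebra.
From mathcomp Require Import all_classical all_reals all_analysis.
From mathcomp Require Import ring.
Import Order.TTheory GRing.Theory Num.Theory.
Import numFieldNormedType.Exports.
Set Implicit Arguments.
Unset Strict Implicit.
Unset Printing Implicit Defensive.
Local Open Scope classical_set_scope.
Local Open Scope ring_scope.

(** * Column stochastic matrices and positivity of their powers *)

Lemma sum_mulmx_column_stochastic (R : realType) (p q : nat) (M : 'M[R]_(p, q))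
    (v : 'cV[R]_q) :
  column_stochastic M -> \sum_i (M *m v) i 0 = \sum_j v j 0.
Proof.
move=> [_ M1]; under eq_bigr do rewrite mxE.
rewrite exchange_big /=; apply: eq_bigr => j _.
by rewrite -mulr_suml M1 mul1r.
Qed.

Lemma column_stochastic_exp (R : realType) (n : nat) (A : 'M[R]_n) (k : nat) :
  column_stochastic A -> column_stochastic (A ^+ k).
Proof.
move=> [A0 A1]; elim: k => [|k [IH0 IH1]].
  split=> [i j|j]; first by rewrite expr0 mxE ler0n.
  rewrite (bigD1 j) //= expr0 mxE eqxx big1 ?addr0 // => i ij.
  by rewrite mxE (negbTE ij).
split=> [i j|j]; rewrite exprS -mulmxE.
  by rewrite mxE; apply: sumr_ge0 => l _; rewrite mulr_ge0.
under eq_bigr do rewrite mxE.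
rewrite exchange_big /= -[RHS](IH1 j); apply: eq_bigr => l _.
by rewrite -mulr_suml A1 mul1r.
Qed.

(** The path from [j] to [i] contributes a positive product of weights to the entry; all other terms
    are nonnegative. *)
Lemma exp_gt0_connect (R : realType) (n : nat) (A : 'M[R]_n) (e : rel 'I_n)
    (j i : 'I_n) :
  column_stochastic A -> (forall a b, e b a -> 0 < A a b) ->
  connect e j i -> exists k, 0 < (A ^+ k) i j.
Proof.
move=> SA Ae /connectP[p].
elim/last_ind: p i => [|p a IH] i /=.
  by move=> _ ->; exists 0%N; rewrite expr0 mxE eqxx.
rewrite rcons_path last_rcons => /andP[ep ea] ->.
have [k Hk] := IH _ ep erefl.
have [[A0 _] [B0 _]] := (SA, column_stochastic_exp k SA).
exists k.+1; rewrite exprS -mulmxE mxE (bigD1 (last j p)) //=.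
apply: ltr_pwDl; first by rewrite mulr_gt0 // Ae.
by apply: sumr_ge0 => l _; rewrite mulr_ge0 // B0.
Qed.

(** The positive diagonal lets a walk wait at its endpoint [i], so positivity persists in later
    powers. *)
Lemma exp_gt0_ge (R : realType) (n : nat) (A : 'M[R]_n) (k l : nat)
    (i j : 'I_n) :
  column_stochastic A -> (forall a, 0 < A a a) -> (k <= l)%N ->
  0 < (A ^+ k) i j -> 0 < (A ^+ l) i j.
Proof.
move=> SA Ad /subnK <- Ak; elim: (l - k)%N => [|d IH]; first by rewrite add0n.
have [A0 _] := SA; have [B0 _] := column_stochastic_exp (d + k) SA.
rewrite addSn exprS -mulmxE mxE (bigD1 i) //=.
apply: ltr_pwDl; first by rewrite mulr_gt0.
by apply: sumr_ge0 => b _; rewrite mulr_ge0.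
Qed.

Lemma column_stochastic_primitive (R : realType) (n : nat) (A : 'M[R]_n)
    (e : rel 'I_n) :
  column_stochastic A -> (forall a, 0 < A a a) ->
  (forall a b, e b a -> 0 < A a b) -> (forall a b, connect e a b) ->
  exists N : nat, exists2 d : R,
    0 < d & forall i j, d <= (A ^+ N.+1) i j.
Proof.
move=> SA Ad Ae conn.
have /choice[K HK] : forall p : 'I_n * 'I_n, exists k, 0 < (A ^+ k) p.1 p.2.
  by move=> [i j]; apply: exp_gt0_connect (conn _ _).
(* The largest of the exponents serves all pairs at once. *)
pose N := (\max_p K p)%N; exists N.
exists (\big[Order.min/1]_(p : 'I_n * 'I_n) (A ^+ N.+1) p.1 p.2).
  apply/bigmin_gtP; split=> // p _.
  by apply: exp_gt0_ge (HK p) => //; apply: leqW; apply: leq_bigmax.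
by move=> i j; apply: (bigmin_le _ (i, j)).
Qed.

(* Subtracting the constant [d] from every entry of [B] leaves a nonnegative
   matrix with column sums [1 - n d]. *)
Lemma norm1_mulmx_le (R : realType) (n : nat) (B : 'M[R]_n) (d : R)
    (v : 'cV[R]_n) :
  column_stochastic B -> (forall i j, d <= B i j) -> 0 <= d ->
  \sum_i `|(B *m v) i 0| <=
    (1 - n%:R * d) * (\sum_i `|v i 0|) + n%:R * d * `|\sum_i v i 0|.
Proof.
move=> [_ B1] Bd d0.
have -> : (1 - n%:R * d) * (\sum_i `|v i 0|) + n%:R * d * `|\sum_i v i 0| =
  \sum_i (\sum_j (B i j - d) * `|v j 0| + d * `|\sum_i v i 0|).
  rewrite big_split /= sumr_const card_ord -[(_ * _) *+ n]mulr_natl mulrA.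
  congr (_ + _).
  rewrite exchange_big /= mulr_sumr; apply: eq_bigr => j _.
  by rewrite -mulr_suml sumrB B1 sumr_const card_ord mulr_natl.
apply: ler_sum => i _; rewrite mxE.
have -> : \sum_j B i j * v j 0 =
    \sum_j (B i j - d) * v j 0 + d * \sum_i v i 0.
  by rewrite mulr_sumr -big_split; apply: eq_bigr => j _ /=; ring.
apply: (le_trans (ler_normD _ _)).
rewrite normrM (ger0_norm d0) lerD2r.
apply: (le_trans (ler_norm_sum _ _ _)); apply: ler_sum => j _.
by rewrite normrM ger0_norm ?subr_ge0.
Qed.

(** * Bounds and growth for affine iterations *)

Lemma contraction_bounded (R : realType) (u : nat -> R) (N : nat) (r C : R) :
  0 <= r < 1 -> (forall k, u (k + N.+1)%N <= r * u k + C) ->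
  exists M, forall k, u k <= M.
Proof.
move=> /andP[r0 r1] Hu.
(* [C / (1 - r)] is the fixed point of [t |-> r * t + C], so any larger bound is preserved; the
   first [N.+1] values start the induction. *)
pose M := Order.max (C / (1 - r)) (\big[Order.max/0]_(i < N.+1) u i).
have MC : r * M + C <= M.
  have : C / (1 - r) <= M by rewrite /M le_max lexx.
  by rewrite ler_pdivrMr ?subr_gt0 // mulrBr mulr1 lerBrDr (mulrC M) addrC.
exists M; elim/ltn_ind => k IH.
case: (ltnP k N.+1) => kN.
  rewrite /M le_max; apply/orP; right.
  exact: (le_bigmax _ (fun i : 'I_N.+1 => u i) (Ordinal kN)).
rewrite -(subnK kN); apply: le_trans (Hu _) _; apply: le_trans MC.
by rewrite lerD2r ler_wpM2l // IH // ltn_subrL /= (leq_trans _ kN).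
Qed.

Lemma affine_iter (R : realType) (n : nat) (A : 'M[R]_n) (d : 'cV[R]_n)
    (y : nat -> 'cV[R]_n) (k N : nat) :
  (forall k, y k.+1 = A *m y k + d) ->
  y (k + N)%N = A ^+ N *m y k + \sum_(l < N) A ^+ l *m d.
Proof.
move=> Hy; elim: N => [|N IH].
  by rewrite addn0 expr0 big_ord0 addr0 -[1]/(1%:M) mul1mx.
rewrite addnS Hy IH mulmxDr big_ord_recl expr0 -[1]/(1%:M) mul1mx.
rewrite mulmxA exprS -mulmxE -addrA; congr (_ + _).
rewrite addrC mulmx_sumr; congr (_ + _); apply: eq_bigr => l _.
by rewrite mulmxA exprS -mulmxE.
Qed.

Lemma affine_sum (R : realType) (n : nat) (A : 'M[R]_n) (d : 'cV[R]_n)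
    (y : nat -> 'cV[R]_n) (k : nat) :
  column_stochastic A -> (forall k, y k.+1 = A *m y k + d) ->
  \sum_i y k i 0 = \sum_i y 0%N i 0 + k%:R * \sum_i d i 0.
Proof.
move=> SA Hy; elim: k => [|k IH]; first by rewrite mul0r addr0.
rewrite Hy; under eq_bigr do rewrite mxE.
rewrite big_split /= (sum_mulmx_column_stochastic _ SA) IH.
by rewrite -addrA; congr (_ + _); rewrite -natr1; ring.
Qed.

Lemma affine_bounded (R : realType) (n N : nat) (A : 'M[R]_n) (e : R)
    (d : 'cV[R]_n) (y : nat -> 'cV[R]_n) (i : 'I_n) :
  column_stochastic A -> 0 < e -> (forall i j, e <= (A ^+ N.+1) i j) ->
  (forall k, y k.+1 = A *m y k + d) -> \sum_i d i 0 = 0 ->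
  exists M, forall k, `|y k i 0| <= M.
Proof.
move=> SA e0 Ae Hy d0; have SB := column_stochastic_exp N.+1 SA.
set D := \sum_(l < N.+1) A ^+ l *m d.
have n0 : 0 < n%:R :> R by rewrite ltr0n (leq_trans _ (ltn_ord i)).
(* A column of [A ^+ N.+1] sums to 1 and has [n] entries, each at least [e]. *)
have r01 : 0 <= 1 - n%:R * e < 1.
  rewrite subr_ge0 gtrBl mulr_gt0 // andbT.
  rewrite mulr_natl -[leRHS](SB.2 i) -[in leLHS](card_ord n) -sumr_const.
  exact: ler_sum.
have [|M HM] := @contraction_bounded _ (fun k => \sum_i `|y k i 0|) N
    (1 - n%:R * e) (n%:R * e * `|\sum_i y 0%N i 0| + \sum_i `|D i 0|) r01.
  move=> k; rewrite (affine_iter k N.+1 Hy) -/D.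
  have sk : \sum_i y 0%N i 0 = \sum_i y k i 0.
    by rewrite (affine_sum k SA Hy) d0 mulr0 addr0.
  rewrite sk addrA; apply: le_trans (lerD _ (lexx _)); last first.
    exact: norm1_mulmx_le SB Ae (ltW e0).
  by rewrite -big_split; apply: ler_sum => l _ /=; rewrite mxE ler_normD.
exists M => k; apply: le_trans (HM k).
by rewrite (bigD1 i) //= lerDl sumr_ge0.
Qed.

(** After [k] steps the total mass is at least [k] times that of [d]; [A ^+ N] then passes a
    fraction [e] of it to every entry, and the later inputs only add to it. *)
Lemma affine_growth (R : realType) (n N : nat) (A : 'M[R]_n) (e : R)
    (d : 'cV[R]_n) (y : nat -> 'cV[R]_n) :
  column_stochastic A -> 0 < e -> (forall i j, e <= (A ^+ N) i j) ->
  (forall k, y k.+1 = A *m y k + d) ->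
  (forall i, 0 <= d i 0) -> (forall i, 0 <= y 0%N i 0) ->
  forall k i, e * (k%:R * \sum_i d i 0) <= y (k + N)%N i 0.
Proof.
move=> SA e0 Ae Hy d0 y0 k i.
have mul_ge0 (M : 'M[R]_n) (v : 'cV[R]_n) : column_stochastic M ->
    (forall a, 0 <= v a 0) -> forall a, 0 <= (M *m v) a 0.
  by move=> [M0 _] v0 a; rewrite mxE sumr_ge0 // => b _; rewrite mulr_ge0.
have yk l a : 0 <= y l a 0.
  by elim: l a => // l IH a; rewrite Hy mxE addr_ge0 // mul_ge0.
rewrite (affine_iter k N Hy) mxE summxE.
apply: ler_wpDr.
  by apply: sumr_ge0 => l _; apply: mul_ge0 => //; apply: column_stochastic_exp.
rewrite mxE; apply: (@le_trans _ _ (e * \sum_i y k i 0)).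
  by rewrite ler_pM2l // (affine_sum k SA Hy) lerDr sumr_ge0.
by rewrite mulr_sumr; apply: ler_sum => j _; rewrite ler_wpM2r.
Qed.

(** * Follower dynamics driven by the leaders, and the limit *)

Lemma block_step (R : realType) (f m : nat) (A1 : 'M[R]_f) (A2 : 'M[R]_(f, m))
    (z : nat -> 'cV[R]_(f + m)) :
  (forall k, z k.+1 = block_mx A1 A2 0 1%:M *m z k) ->
  forall k, usubmx (z k.+1) = A1 *m usubmx (z k) + A2 *m dsubmx (z 0%N).
Proof.
move=> Hz.
have step k : z k.+1 = col_mx (A1 *m usubmx (z k) + A2 *m dsubmx (z k))
    (dsubmx (z k)).
  by rewrite Hz -{1}(vsubmxK (z k)) mul_block_col mul0mx mul1mx add0r.
have low k : dsubmx (z k) = dsubmx (z 0%N).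
  by elim: k => // k IH; rewrite step col_mxKd.
by move=> k; rewrite step col_mxKu low.
Qed.

Lemma cvg_ratio_0 (R : realType) (y w : nat -> R) (M e : R) (N : nat) :
  0 < e -> (forall k, `|y k| <= M) -> (forall k, e * k%:R <= w (k + N)%N) ->
  y k / w k @[k --> \oo] --> 0.
Proof.
move=> e0 yM wk; rewrite -(cvg_shiftn N).
(* The extra shift skips [k = 0], where the lower bound on [w] vanishes, and turns the majorant into
   a multiple of [harmonic]. *)
rewrite -(cvg_shiftS (fun n => y (n + N)%N / w (n + N)%N)).
apply: norm_cvg0.
apply: (@squeeze_cvgr _ _ _ _ (fun=> 0) (fun k => M / e * harmonic k)).
- apply: nearW => k /=; rewrite normr_ge0 /=.
  have w0 : 0 < w (k.+1 + N)%N by apply: lt_le_trans (wk _); rewrite mulr_gt0.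
  rewrite normrM normfV (gtr0_norm w0) -mulrA -invfM.
  apply: ler_pM => //; first by rewrite invr_ge0 ltW.
  by rewrite lef_pV2 ?posrE ?mulr_gt0.
- exact: cvg_cst.
- rewrite -[X in _ --> X](mulr0 (M / e)).
  by apply: cvgM; [exact: cvg_cst|exact: cvg_harmonic].
Qed.

Theorem theorem1 (R : realType) (f m : nat) (G : wdigraph R (f + m))
    (A1 : 'M[R]_f) (A2 : 'M[R]_(f, m))
    (x s w : nat -> 'cV[R]_(f + m)) :
  (1 <= f)%N -> (2 <= m)%N ->
  (* agents are ordered with the f followers first, then the m leaders *)
  (forall i : 'I_(f + m), (i \in leaders G) = (f <= i)%N) ->
  (forall j, j \in leaders G -> exists2 i, i \in followers G & edge G j i) ->
  strongly_connected (induced_rel (edge G) (followers G)) ->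
  adj G = block_mx A1 A2 0 1%:M ->
  column_stochastic A1 ->
  column_stochastic A2 ->
  s 0%N = x 0%N ->
  w 0%N = const_mx 1 ->
  (forall k, s k.+1 = adj G *m s k) ->
  (forall k, w k.+1 = adj G *m w k) ->
  (forall k i, i \in followers G -> x k.+1 i 0 = s k.+1 i 0 / w k.+1 i 0) ->
  (forall k j, j \in leaders G -> x k j 0 = x 0%N j 0) ->
  forall i, i \in followers G ->
    x k i 0 @[k --> \oo] --> m%:R^-1 * \sum_(j in leaders G) x 0%N j 0.
Proof.
move=> _ m2 leadE _ conn adjE SA1 SA2 s0 w0 sS wS xS _ i iF.
have folE (a : 'I_(f + m)) : (a \in followers G) = (a < f)%N.
  by rewrite inE leadE ltnNge.
have m0 : m%:R != 0 :> R by rewrite pnatr_eq0 -lt0n ltnW.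
have A1E a b : A1 a b = adj G (lshift m a) (lshift m b).
  by rewrite adjE block_mxEul.
have lF a : lshift m a \in followers G by rewrite folE /=.
have A1d a : 0 < A1 a a by rewrite A1E adj_diag.
(* The follower subgraph carried over to the index type of [A1]; its connectivity is obtained by
   transporting paths out of the subtype, vertex by vertex. *)
pose e := relpre (lshift m) (edge G).
have A1e a b : e b a -> 0 < A1 a b.
  move=> eba; rewrite A1E; apply: adj_edge => //.
  apply/eqP => /lshift_inj ab; move: eba.
  by rewrite /e /= ab edge_irrefl.
pose emb a : {v | v \in followers G} := exist _ (lshift m a) (lF a).
have A1conn a b : connect e a b.
  have [->|ab] := eqVneq a b; first exact: connect0.
  have := conn (emb a) (emb b).
  rewrite -val_eqE /= (inj_eq (@lshift_inj _ _)) => /(_ ab) /connectP[p].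
  elim: p a {ab} => [|c p IH] a /=.
    by move=> _ /(congr1 val) /= /lshift_inj ->.
  move=> /andP[ac cp] blast.
  have cf : (val c < f)%N by rewrite -folE (valP c).
  have cE : c = emb (Ordinal cf) by apply/val_inj/val_inj.
  apply: (connect_trans (y := Ordinal cf)); last first.
    by apply: IH; rewrite -cE.
  by apply: connect1; rewrite /e /=; move: ac; rewrite {1}cE.
have [N [d d0 Ad]] := column_stochastic_primitive SA1 A1d A1e A1conn.
set c := m%:R^-1 * _.
have cE : c = m%:R^-1 * \sum_(j < m) x 0%N (rshift f j) 0.
  congr (_ * _); rewrite big_split_ord /= big_pred0 ?add0r.
    by apply: eq_bigl => j; rewrite leadE /= leq_addr.
  by move=> j; rewrite leadE /= leqNgt ltn_ord.
pose y k := s k - c *: w k.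
have yS k : y k.+1 = block_mx A1 A2 0 1%:M *m y k.
  by rewrite /y sS wS adjE mulmxBr scalemxAr.
have iE : i = lshift m (Ordinal (eq_ind _ is_true iF _ (folE i))).
  exact/val_inj.
move: (Ordinal _) iE => i' {iF} ->.
(* The side goal is that the forcing [A2 *m dsubmx (y 0%N)] sums to zero: [A2] preserves sums, and
   the leader entries of [y 0%N] are deviations from their mean [c]. *)
have [|M HM] := affine_bounded i' SA1 d0 Ad (block_step yS).
  rewrite (sum_mulmx_column_stochastic _ SA2).
  under eq_bigr do rewrite !mxE w0 mxE s0 mulr1.
  rewrite big_split /= sumr_const card_ord mulNrn -[c *+ m]mulr_natl cE.
  by rewrite mulVKf // subrr.
have wS' k : w k.+1 = block_mx A1 A2 0 1%:M *m w k by rewrite wS adjE.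
have dge a : 0 <= (A2 *m dsubmx (w 0%N)) a 0.
  by rewrite mxE sumr_ge0 // => b _; rewrite w0 !mxE mulr1; case: SA2.
have wge a : 0 <= usubmx (w 0%N) a 0 by rewrite w0 !mxE.
have wk := affine_growth SA1 d0 Ad (block_step wS') dge wge.
have sumw : \sum_i (A2 *m dsubmx (w 0%N)) i 0 = m%:R.
  rewrite (sum_mulmx_column_stochastic _ SA2).
  under eq_bigr do rewrite w0 !mxE.
  by rewrite sumr_const card_ord.
have dm0 : 0 < d * m%:R by rewrite mulr_gt0 // lt_neqAle eq_sym m0 ler0n.
have wl k : d * m%:R * k%:R <= w (k + N.+1)%N (lshift m i') 0.
  by have := wk k i'; rewrite sumw mxE mulrAC mulrA.
have yl k : `|y k (lshift m i') 0| <= M by have := HM k; rewrite mxE.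
have lim := cvg_ratio_0 (w := fun k => w k (lshift m i') 0) dm0 yl wl.
(* The index [k + N.+2] is a successor, as [xS] requires, and equals [k.+1 + N.+1], where [wl] gives
   a positive denominator. *)
rewrite -(cvg_shiftn N.+2) in lim; rewrite -(cvg_shiftn N.+2).
(* The follower state is [c + y / w] with [y = s - c *: w], so adding [c] to the null limit gives
   the claim. *)
move: lim => /(cvgD (cvg_cst c)); rewrite addr0.
apply: cvg_trans; apply: near_eq_cvg; apply: nearW => k /=.
have w_gt0 : 0 < w (k + N.+2)%N (lshift m i') 0.
  by rewrite -addSnnS; apply: lt_le_trans (wl _); rewrite mulr_gt0.
rewrite addnS xS // -addnS fctE /y !mxE.
by field; rewrite gt_eqF.
Qed.
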